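(* Let $(X,d)$ be a complete metric space and let $S,T:X\to CB(X)$ be a duality of generalized weak contractions with associated function $\alpha:X\times X\to[0,1)$, i.e. $H(Sx,Ty)\le \alpha(x,y)M(x,y)$ for all $x,y\in X$. Suppose that for every sequence $\{x_n\}_{n\ge 0}$ in $X$ such that the sequence $\{d(x_n,x_{n+1})\}$ is monotone decreasing one has $$\sup\{\alpha(x_{2k-2},x_{2k-1}),\ \alpha(x_{2k},x_{2k-1}) \mid k\in\mathbb{N}\}<1 .$$ Suppose moreover that $\alpha$ is upper semicontinuous on $X\times X$ (or, alternatively, that $\limsup_{n\to\infty}\alpha(x_n,x^\ast)<1$ whenever $\{x_n\}$ is a sequence in $X$ with $\lim_{n\to\infty}x_n=x^\ast\in X$). Then $Fix(S)=Fix(T)\neq\emptyset$.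
   Context: $X$ is nonempty. $CB(X)$ is the class of nonempty closed and bounded subsets of the metric space $(X,d)$. For $x\in X$ and $A\subseteq X$, $d(x,A)=\inf_{a\in A}d(x,a)$. $H$ is the Hausdorff metric on $CB(X)$: $H(A,B)=\max\{\sup_{x\in B}d(x,A),\ \sup_{x\in A}d(x,B)\}$. For $S,T:X\to CB(X)$, put $$M(x,y)=\max\Big\{d(x,y),\ d(x,Sx),\ d(y,Ty),\ \tfrac{d(x,Ty)+d(y,Sx)}{2}\Big\}.$$ The mappings $S,T:X\to CB(X)$ are called a duality of generalized weak contractions if there exists $\alpha:X\times X\to[0,1)$ such that $H(Sx,Ty)\le\alpha(x,y)M(x,y)$ for all $x,y\in X$. $Fix(T)=\{x\in X: x\in Tx\}$. $\mathbb{N}=\{1,2,3,\dots\}$. *)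

(* Defs.v *)
From HB Require Import structures.
From mathcomp Require Import all_boot all_order all_algebra.
From mathcomp Require Import all_classical all_reals all_analysis.

Set Implicit Arguments.
Unset Strict Implicit.
Unset Printing Implicit Defensive.

Import Order.TTheory GRing.Theory Num.Theory.
Import numFieldNormedType.Exports.

Local Open Scope classical_set_scope.
Local Open Scope ring_scope.

(* [Complete] includes a base point, so a [completeMetricType] is nonempty. *)
#[short(type="completeMetricType")]
HB.structure Definition CompleteMetric (R : numFieldType) :=
  {T of Complete T & Metric R T}.

Section Definitions.
Context {R : realType} {X : metricType R}.
Implicit Types (x y : X) (A B : set X) (S T : X -> set X).

Definition metric_bounded A : Prop :=
  exists r : R, forall x y, A x -> A y -> mdist x y <= r.

Definition CB : set (set X) :=
  [set A | [/\ A !=set0, closed A & metric_bounded A]].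

(* [inf] and [sup] are real-valued, with a default value on empty or unbounded
   sets; both are genuine when the sets below are in [CB]. *)
Definition setdist x A : R := inf [set mdist x a | a in A].

Definition Hausdorff A B : R :=
  Num.max (sup [set setdist x A | x in B]) (sup [set setdist x B | x in A]).

Definition Mmax S T x y : R :=
  Num.max (Num.max (mdist x y) (setdist x (S x)))
    (Num.max (setdist y (T y)) ((setdist x (T y) + setdist y (S x)) / 2)).

Definition duality_gwc_with S T (alpha : X * X -> R) : Prop :=
  [/\ forall x, CB (S x), forall x, CB (T x),
      forall p, 0 <= alpha p < 1 &
      forall x y, Hausdorff (S x) (T y) <= alpha (x, y) * Mmax S T x y].

Definition Fix T : set X := [set x | T x x].

End Definitions.

Definition upper_semicontinuous {R : realType} {T : topologicalType}
    (f : T -> R) : Prop :=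
  forall (x : T) (a : R), f x < a -> \forall y \near x, f y < a.

(* Main.v *)
(* Starting from [x 1] in [S (x 0)], orbit points are chosen alternately in
   [T (x n)] and [S (x n)].  For [y] in [S x], every term of [Mmax S T x y] is
   controlled by [mdist x y] and [setdist y (T y)], so that
   [setdist y (T y) <= alpha (x, y) * mdist x y]; hence the next point can be
   chosen with contraction factor [(1 + alpha (x, y)) / 2].  The step lengths
   are then nonincreasing, the hypothesis on [sup] bounds these factors away
   from 1, and the orbit is Cauchy.  Bounding [alpha (x (2 * k), xstar)] away
   from 1 shows that the limit [xstar] is a fixed point of [T].  Finally
   [Mmax S T x x] reduces to [setdist x (S x)] when [x] is fixed by [T], so
   that the fixed points of [S] and [T] coincide. *)

Require Import Defs.
From mathcomp Require Import all_boot all_order all_algebra.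
From mathcomp Require Import all_classical all_reals all_analysis.
From mathcomp Require Import lra zify.

Import Order.TTheory GRing.Theory Num.Theory.
Import numFieldNormedType.Exports.

Local Open Scope classical_set_scope.
Local Open Scope ring_scope.

(** * Point-to-set distance and the Hausdorff metric *)

Section SetDistance.
Context {R : realType} {X : metricType R}.
Implicit Types (x y : X) (A B : set X).

Lemma setdist_le x A a : A a -> setdist x A <= mdist x a.
Proof.
move=> Aa; apply: ge_inf; last by exists a.
by exists 0 => _ [b _ <-]; exact: mdist_ge0.
Qed.

Lemma le_setdist x A e : A !=set0 -> (forall a, A a -> e <= mdist x a) ->
  e <= setdist x A.
Proof.
move=> [a Aa] eA; apply: lb_le_inf; first by exists (mdist x a), a.
by move=> _ [b Ab <-]; exact: eA.
Qed.

Lemma setdist_ge0 x A : A !=set0 -> 0 <= setdist x A.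
Proof. by move=> A0; apply: le_setdist => // a _; exact: mdist_ge0. Qed.

Lemma setdist_mem x A : A x -> setdist x A = 0.
Proof.
move=> Ax; apply/eqP; rewrite eq_le setdist_ge0; last by exists x.
by rewrite andbT -(mdistxx x) setdist_le.
Qed.

Lemma setdist_lt x A e : A !=set0 -> setdist x A < e ->
  exists2 a, A a & mdist x a < e.
Proof.
move=> [a Aa] /inf_lt[|_ [b Ab <-] be]; first by exists (mdist x a), a.
by exists b.
Qed.

Lemma setdist_triangle x y A : A !=set0 ->
  setdist x A <= mdist x y + setdist y A.
Proof.
move=> A0; rewrite -lerBlDl; apply: le_setdist => // a Aa.
by rewrite lerBlDl (le_trans (setdist_le x A a Aa))// metric_triangle.
Qed.

Lemma setdist_le0_closed x A : A !=set0 -> closed A -> setdist x A <= 0 -> A x.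
Proof.
move=> A0 cA xA; apply: cA => B /nbhs_ballP[e /= e0 xeB].
have [|a Aa xae] := setdist_lt x A e A0; first exact: le_lt_trans e0.
by exists a; split => //; apply: xeB; rewrite ballEmdist.
Qed.

Lemma HausdorffC A B : Hausdorff A B = Hausdorff B A.
Proof. by rewrite /Hausdorff maxC. Qed.

(** Boundedness of [A] and a point of [B] bound the distances to [B] from above, so the [sup] in
    [Hausdorff] is a true supremum and not a default value. *)
Lemma setdist_le_Hausdorff A B x : CB A -> CB B -> A x ->
  setdist x B <= Hausdorff A B.
Proof.
move=> [_ _ [r rA]] [[b Bb] _ _] Ax; rewrite /Hausdorff le_max.
apply/orP; right; apply: ub_le_sup; last by exists x.
exists (r + mdist x b) => _ [z Az <-].
rewrite (le_trans (setdist_le z B b Bb))//.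
by rewrite (le_trans (metric_triangle z x b))// lerD2r rA.
Qed.

Lemma MmaxC (S T : X -> set X) x y : Mmax S T x y = Mmax T S y x.
Proof.
rewrite /Mmax (metric_sym x y) (addrC (setdist x (T y))).
by rewrite -!maxA; congr Num.max; rewrite !maxA (maxC (setdist x (S x))).
Qed.

End SetDistance.

(** * Pointwise consequences of the contraction condition, and the orbit *)

Section Duality.
Context {R : realType} {X : metricType R}.
Implicit Types (x y : X) (S T : X -> set X) (alpha : X * X -> R).

(** The hypothesis is symmetric once the arguments of [alpha] are swapped, so each one-sided lemma
    below serves both maps. *)
Lemma duality_gwc_withC S T alpha : duality_gwc_with S T alpha ->
  duality_gwc_with T S (fun p => alpha (p.2, p.1)).
Proof.
move=> [CS CT a01 H]; split => // x y.
by rewrite HausdorffC MmaxC; exact: H.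
Qed.

Lemma gwc_setdist_le S T alpha x y : duality_gwc_with S T alpha -> S x y ->
  setdist y (T y) <= alpha (x, y) * mdist x y.
Proof.
move=> [CS CT a01 H] Sxy; have /andP[a0 a1] := a01 (x, y).
have Ty0 : T y !=set0 by case: (CT y).
have D0 := setdist_ge0 y (T y) Ty0.
have d0 := mdist_ge0 x y.
have : setdist y (T y) <= alpha (x, y) * Mmax S T x y.
  exact: le_trans (setdist_le_Hausdorff _ _ y (CS x) (CT y) Sxy) (H x y).
(* As [setdist y (S x) = 0], the averaged term is at most the mean of [mdist x y] and
   [setdist y (T y)], hence at most their maximum. *)
have : Mmax S T x y <= Num.max (mdist x y) (setdist y (T y)).
  have := setdist_triangle x y (T y) Ty0.
  have := setdist_le x (S x) y Sxy.
  rewrite /Mmax (setdist_mem y (S x) Sxy).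
  by case: (leP (mdist x y) (setdist y (T y))) => *; rewrite !ge_max; lra.
(* If [setdist y (T y)] were the strict maximum, it would be positive and at most [alpha (x, y)]
   times itself, which is absurd. *)
have [dD MD DM|Dd Md DM] := ltP (mdist x y) (setdist y (T y)).
  have : alpha (x, y) * Mmax S T x y <= alpha (x, y) * setdist y (T y).
    exact: ler_wpM2l.
  nra.
by apply: le_trans DM _; exact: ler_wpM2l.
Qed.

Lemma gwc_step S T alpha x y : duality_gwc_with S T alpha -> S x y ->
  exists2 z, T y z & mdist y z <= (1 + alpha (x, y)) / 2 * mdist x y.
Proof.
move=> hST Sxy; have D := gwc_setdist_le _ _ _ x y hST Sxy.
have [_ CT a01 _] := hST; have /andP[a0 a1] := a01 (x, y).
have [Ty0 cTy _] := CT y.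
(* A zero step leaves no strict room; then [y] itself lies in the closed set [T y]. *)
have [xy0|xy0] := eqVneq (mdist x y) 0.
  exists y; last by rewrite mdistxx xy0 mulr0.
  by apply: setdist_le0_closed => //; rewrite xy0 mulr0 in D.
have d0 : 0 < mdist x y by rewrite lt_def xy0 mdist_ge0.
(* The midpoint of [alpha (x, y)] and 1 strictly exceeds [alpha (x, y)], so the infimum is
   approached closely enough by a point of [T y]. *)
have [|z Tyz yz] := setdist_lt y (T y) ((1 + alpha (x, y)) / 2 * mdist x y) Ty0.
  by nra.
by exists z => //; exact: ltW.
Qed.

Lemma gwc_Fix_sub S T alpha : duality_gwc_with S T alpha -> Fix T `<=` Fix S.
Proof.
move=> [CS CT a01 H] x Tx; have /andP[a0 a1] := a01 (x, x).
have [Sx0 cSx _] := CS x.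
have D0 := setdist_ge0 x (S x) Sx0.
apply: (setdist_le0_closed x (S x)) => //.
have DM : setdist x (S x) <= alpha (x, x) * Mmax S T x x.
  apply: le_trans (H x x); rewrite HausdorffC.
  exact: setdist_le_Hausdorff.
have MD : Mmax S T x x <= setdist x (S x).
  rewrite /Mmax mdistxx (setdist_mem x (T x) Tx) !ge_max; lra.
nra.
Qed.

Lemma gwc_orbit S T alpha x0 : duality_gwc_with S T alpha ->
  exists x : nat -> X, [/\ forall k, S (x k.*2) (x k.*2.+1),
    forall k, mdist (x k.*2.+1) (x k.*2.+2) <=
      (1 + alpha (x k.*2, x k.*2.+1)) / 2 * mdist (x k.*2) (x k.*2.+1) &
    forall k, mdist (x k.*2.+2) (x k.*2.+3) <=
      (1 + alpha (x k.*2.+2, x k.*2.+1)) / 2 * mdist (x k.*2.+1) (x k.*2.+2)].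
Proof.
move=> hST; have hTS := duality_gwc_withC _ _ _ hST.
have [/(_ x0)[[x1 Sx01] _ _] _ _ _] := hST.
(* The iterated state is a pair of consecutive orbit points, the second in [S] of the first; one
   [step] advances by two points, so no parity enters the choice. *)
pose inS (p : X * X) := S p.1 p.2.
pose step (p q : X * X) :=
  [/\ S q.1 q.2,
    mdist p.2 q.1 <= (1 + alpha (p.1, p.2)) / 2 * mdist p.1 p.2 &
    mdist q.1 q.2 <= (1 + alpha (q.1, p.2)) / 2 * mdist p.2 q.1].
have /choice[f fP] : forall p, exists q, inS p -> step p q.
  move=> [x y]; have [Sxy|nSxy] := pselect (S x y); last by exists (x, y).
  have [z Tyz yz] := gwc_step _ _ _ x y hST Sxy.
  (* The swapped function of [hTS] yields [alpha (z, y)], with the argument of [S] first. *)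
  have [w Szw zw] := gwc_step _ _ _ y z hTS Tyz.
  by exists (z, w).
pose p n := iter n f (x0, x1).
have pS n : inS (p n) by elim: n => [//|n /fP[]].
have pstep n : step (p n) (p n.+1) by exact: fP.
exists (fun n => if odd n then (p n./2).2 else (p n./2).1).
by split=> k; rewrite /= ?odd_double ?uphalf_double ?doubleK/=;
  [exact: pS | have [] := pstep k | have [] := pstep k].
Qed.

End Duality.

(** * Convergence and limits *)

Lemma contraction_seq_cvg (R : realType) (X : completeMetricType R)
    (x : nat -> X) (q : R) : 0 <= q < 1 ->
  (forall n, mdist (x n.+1) (x n.+2) <= q * mdist (x n) (x n.+1)) ->
  cvgn x.
Proof.
move=> /andP[q0 q1] xq.
(* The geometric tail estimate without sums: peel off the first step and apply the induction
   hypothesis from [n.+1]. *)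
have tail n k : (1 - q) * mdist (x n) (x (k + n)%N) <= mdist (x n) (x n.+1).
  elim: k n => [|k IH] n; first by rewrite add0n mdistxx mulr0 mdist_ge0.
  have := metric_triangle (x n) (x n.+1) (x (k.+1 + n)%N).
  by have := IH n.+1; have := xq n; rewrite addnS -addSn; nra.
have dle n : mdist (x n) (x n.+1) <= mdist (x 0%N) (x 1%N) * q ^+ n.
  elim: n => [|n IH]; first by rewrite expr0 mulr1.
  by rewrite (le_trans (xq n))// exprS mulrCA ler_wpM2l.
have d0 : (mdist (x 0%N) (x 1%N) * q ^+ n) @[n --> \oo] --> (0 : R).
  by apply: cvg_geometric; rewrite ger0_norm.
apply: cauchy_cvg; apply: cauchy_exP => e /= e0.
have : 0 < (1 - q) * e by rewrite mulr_gt0// subr_gt0.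
move=> /(cvgr_lt 0 d0)[N _ /(_ N (leqnn N))/= dN].
exists (x N); exists N => // n /= Nn.
rewrite ballEmdist /=; have := tail N (n - N)%N; rewrite subnK// => tN.
have := dle N; have : 0 < 1 - q by rewrite subr_gt0.
by move=> ? ?; rewrite -(ltr_pM2l (_ : 0 < 1 - q))//; lra.
Qed.

(** The upper limit is the infimum of the tail suprema, so some tail supremum lies below [a] and
    serves as [c]. *)
Lemma limn_sup_lt_near (R : realType) (u : nat -> R) (a : R) :
  bounded_fun u -> limn_sup u < a ->
  exists2 c, c < a & \forall n \near \oo, u n <= c.
Proof.
move=> bu; rewrite limn_supE// => /inf_lt[|_ [N _ <-] Na].
  by exists (sups u 0%N), 0%N.
exists (sups u N) => //; exists N => // n /= Nn.
apply: ub_le_sup; last by exists n.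
have [M uM] := bounded_fun_has_ubound bu.
by exists M => _ [k _ <-]; apply: uM; exists k.
Qed.

(** Reduces both alternatives on [alpha] to the one bound needed at the limit point. *)
Lemma usc_or_limn_sup_near (R : realType) (X : topologicalType)
    (alpha : X * X -> R) : (forall p, 0 <= alpha p < 1) ->
    (upper_semicontinuous alpha \/
      forall (x : nat -> X) (xstar : X), x n @[n --> \oo] --> xstar ->
        limn_sup (fun n => alpha (x n, xstar)) < 1) ->
  forall (x : nat -> X) (xstar : X), x n @[n --> \oo] --> xstar ->
    exists2 c, c < 1 & \forall n \near \oo, alpha (x n, xstar) <= c.
Proof.
move=> a01 [usc|ls] x xs xxs.
  have /andP[_ a1] := a01 (xs, xs).
  exists ((1 + alpha (xs, xs)) / 2); first lra.
  have : (x n, xs) @[n --> \oo] --> (xs, xs).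
    by apply: cvg_pair => //; exact: cvg_cst.
  move=> /(_ _ (usc (xs, xs) ((1 + alpha (xs, xs)) / 2) _))/= H.
  by near=> n; apply: ltW; near: n; apply: H; lra.
apply: limn_sup_lt_near (ls _ _ xxs).
exists 1; split => // M M1 n _ /=.
by have /andP[? ?] := a01 (x n, xs); rewrite ger0_norm//; lra.
Unshelve. all: by end_near.
Qed.

(** Passing through [z n] in [S (y n)] bounds the distance from [xstar] to [T xstar] by [c] times
    itself plus a vanishing error; as [c < 1], it is zero. *)
Lemma gwc_limit_Fix (R : realType) (X : metricType R) (S T : X -> set X)
    (alpha : X * X -> R) (y z : nat -> X) (xstar : X) (c : R) :
  duality_gwc_with S T alpha -> (forall n, S (y n) (z n)) ->
  y n @[n --> \oo] --> xstar -> z n @[n --> \oo] --> xstar ->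
  c < 1 -> (\forall n \near \oo, alpha (y n, xstar) <= c) ->
  Fix T xstar.
Proof.
move=> [CS CT a01 H] Syz yx zx c1 ac.
have [Tx0 cTx _] := CT xstar.
apply: (setdist_le0_closed xstar (T xstar)) => //.
have D0 := setdist_ge0 xstar (T xstar) Tx0.
have De e : 0 < e -> (1 - c) * setdist xstar (T xstar) <= 3 * e.
  move=> e0.
  have ye : \forall n \near \oo, mdist xstar (y n) <= e.
    exact: metricType_numDomainType.cvgr_dist_le yx _ e0.
  have ze : \forall n \near \oo, mdist xstar (z n) <= e.
    exact: metricType_numDomainType.cvgr_dist_le zx _ e0.
  have [n [ye' ze' ac']] : exists n, [/\ mdist xstar (y n) <= e,
      mdist xstar (z n) <= e & alpha (y n, xstar) <= c].
    have : \forall n \near \oo, [/\ mdist xstar (y n) <= e,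
      mdist xstar (z n) <= e & alpha (y n, xstar) <= c].
      by apply: filterS3 ye ze ac => n.
    exact: filter_ex.
  have /andP[a0 _] := a01 (y n, xstar).
  have yz := metric_triangle (y n) xstar (z n).
  have yT := setdist_triangle (y n) xstar (T xstar) Tx0.
  rewrite (metric_sym (y n) xstar) in yz yT.
  have M2e : Mmax S T (y n) xstar <= setdist xstar (T xstar) + 2 * e.
    have := setdist_le (y n) (S (y n)) (z n) (Syz n).
    have := setdist_le xstar (S (y n)) (z n) (Syz n).
    by move=> ? ?; rewrite /Mmax !ge_max (metric_sym (y n)); lra.
  have xT := setdist_triangle xstar (z n) (T xstar) Tx0.
  have zT : setdist (z n) (T xstar) <= alpha (y n, xstar) * Mmax S T (y n) xstar.
    exact: le_trans (setdist_le_Hausdorff _ _ _ (CS _) (CT _) (Syz n)) (H _ _).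
  have aM : alpha (y n, xstar) * Mmax S T (y n) xstar <=
      c * (setdist xstar (T xstar) + 2 * e).
    apply: (le_trans (ler_wpM2l a0 M2e)); apply: ler_wpM2r => //; lra.
  nra.
rewrite leNgt; apply/negP => Dpos.
have P : 0 < (1 - c) * setdist xstar (T xstar) by rewrite mulr_gt0// subr_gt0.
(* With this choice [3 * e] is half of the positive left-hand side. *)
have := De ((1 - c) * setdist xstar (T xstar) / 6).
by rewrite divr_gt0// => /(_ isT); lra.
Qed.

Theorem theorem3p1 (R : realType) (X : completeMetricType R)
    (S T : X -> set X) (alpha : X * X -> R)
    (hST : duality_gwc_with S T alpha)
    (hsup : forall x : nat -> X,
      nonincreasing_seq (fun n => mdist (x n) (x n.+1)) ->
      sup ([set alpha (x (2 * k - 2)%N, x (2 * k - 1)%N) | k in [set k | (1 <= k)%N]]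
           `|` [set alpha (x (2 * k)%N, x (2 * k - 1)%N) | k in [set k | (1 <= k)%N]])
        < 1)
    (halpha : upper_semicontinuous alpha \/
      forall (x : nat -> X) (xstar : X), x n @[n --> \oo] --> xstar ->
        limn_sup (fun n => alpha (x n, xstar)) < 1) :
  Fix S = Fix T /\ Fix T !=set0.
Proof.
split.
  apply/seteqP; split; last exact: gwc_Fix_sub hST.
  exact: gwc_Fix_sub (duality_gwc_withC _ _ _ hST).
have [_ _ a01 _] := hST.
have [x [xS xodd xeven]] := gwc_orbit _ _ _ point hST.
have decr : nonincreasing_seq (fun n => mdist (x n) (x n.+1)).
  apply/nonincreasing_seqP => n.
  have d0 := mdist_ge0 (x n) (x n.+1).
  have [k [->|->]] : exists k, n = k.*2 \/ n = k.*2.+1 by exists n./2; lia.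
    have := xodd k; have := mdist_ge0 (x k.*2) (x k.*2.+1).
    by have := a01 (x k.*2, x k.*2.+1); nra.
  have := xeven k; have := mdist_ge0 (x k.*2.+1) (x k.*2.+2).
  by have := a01 (x k.*2.+2, x k.*2.+1); nra.
have := hsup x decr; set A := (X in sup X); set c := sup A => c1.
(* Makes [c] a genuine upper bound of [A]. *)
have Aub : has_ubound A.
  have a1 u v : alpha (u, v) <= 1 by have /andP[_ /ltW] := a01 (u, v).
  by exists 1 => _ [[k _ <-]|[k _ <-]]; exact: a1.
have codd k : alpha (x k.*2, x k.*2.+1) <= c.
  (* The indices in [A] start at 1, hence the shift to [k.+1]. *)
  apply: ub_le_sup => //; left; exists k.+1 => //.
  by congr (alpha (x _, x _)); lia.
have ceven k : alpha (x k.*2.+2, x k.*2.+1) <= c.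
  apply: ub_le_sup => //; right; exists k.+1 => //.
  by congr (alpha (x _, x _)); lia.
have c0 : 0 <= c by apply: le_trans (codd 0%N); have /andP[] := a01 (x 0%N, x 1%N).
have /cvg_ex[xs xxs] : cvgn x.
  (* Since [c < 1] bounds [alpha] along the orbit, [(1 + c) / 2] is a uniform contraction factor. *)
  apply: (@contraction_seq_cvg _ _ _ ((1 + c) / 2)); first lra.
  move=> n; have [k [->|->]] : exists k, n = k.*2 \/ n = k.*2.+1.
      by exists n./2; lia.
    have := xodd k; have := mdist_ge0 (x k.*2) (x k.*2.+1).
    by have := codd k; nra.
  have := xeven k; have := mdist_ge0 (x k.*2.+1) (x k.*2.+2).
  by have := ceven k; nra.
have subseq (g : nat -> nat) : (forall k, (k <= g k)%N) ->
    x (g k) @[k --> \oo] --> xs.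
  move=> gk; apply: (@cvg_comp _ _ _ g x \oo \oo) => // B [N _ NB].
  by exists N => // k /= Nk; apply: NB => /=; exact: leq_trans (gk k).
have x2 : x k.*2 @[k --> \oo] --> xs by apply: subseq => k; lia.
have x21 : x k.*2.+1 @[k --> \oo] --> xs.
  by apply: (subseq (fun k => k.*2.+1)) => k; lia.
(* Even-indexed points are the arguments of [S], so they occupy the first slot of [alpha]. *)
have [c' c'1 ac'] := usc_or_limn_sup_near _ _ _ a01 halpha _ _ x2.
by exists xs; exact: gwc_limit_Fix hST xS x2 x21 c'1 ac'.
Qed.
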